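(* For every $n\ge1$ and $r,s\in\mathbb{Z}$, $$D_n^{(r)}=\frac{1}{n!}\int_{\mathbb{T}}\frac{d\zeta_1}{2\pi i\zeta_1}\cdots\int_{\mathbb{T}}\frac{d\zeta_n}{2\pi i\zeta_n}\prod_{j=1}^nw(\zeta_j)\zeta_j^{-r}\prod_{1\le j<k\le n}(\zeta_k-\zeta_j)(\zeta_k^{-2}-\zeta_j^{-2}),$$ $$E_n^{(s)}=\frac{1}{n!}\int_{\mathbb{T}}\frac{d\zeta_1}{2\pi i\zeta_1}\cdots\int_{\mathbb{T}}\frac{d\zeta_n}{2\pi i\zeta_n}\prod_{j=1}^nw(\zeta_j)\zeta_j^{-s}\prod_{1\le j<k\le n}(\zeta_k^2-\zeta_j^2)(\zeta_k^{-1}-\zeta_j^{-1}).$$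
   Context: $\mathbb{T}$ is the unit circle, oriented counterclockwise; $w$ is a complex-valued integrable weight on $\mathbb{T}$ with Fourier coefficients $w_k=\int_{\mathbb{T}}\zeta^{-k}w(\zeta)\frac{d\zeta}{2\pi i\zeta}$, $k\in\mathbb{Z}$. $D_n^{(r)}=\det(w_{r+2j-k})_{0\le j,k\le n-1}$ and $E_n^{(s)}=\det(w_{s+j-2k})_{0\le j,k\le n-1}$, where $j$ is the row index and $k$ the column index. *)

(* Defs.v *)
From HB Require Import structures.
From mathcomp Require Import all_boot all_order all_algebra.
From mathcomp Require Import complex.
From mathcomp Require Import all_classical all_reals all_analysis.

Set Implicit Arguments.
Unset Strict Implicit.
Unset Printing Implicit Defensive.

Import Order.TTheory GRing.Theory Num.Theory.

Local Open Scope classical_set_scope.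
Local Open Scope ring_scope.
Local Open Scope complex_scope.

Definition expi (R : realType) (t : R) : R[i] := cos t +i* sin t.

(* A function on the unit circle T is given by a function on R[i], of which
   only the values on T, i.e. at the points [expi t], are ever used. *)

Definition circle_integrable (R : realType) (f : R[i] -> R[i]) : Prop :=
  (@lebesgue_measure R).-integrable `[0, 2 * pi]
    (fun t => (complex.Re (f (expi t)))%:E) /\
  (@lebesgue_measure R).-integrable `[0, 2 * pi]
    (fun t => (complex.Im (f (expi t)))%:E).

Definition complex_integral (R : realType) (A : set R) (f : R -> R[i]) :
    R[i] :=
  (\int[@lebesgue_measure R]_(t in A) complex.Re (f t)) +i*
  (\int[@lebesgue_measure R]_(t in A) complex.Im (f t)).

(* int_T f(z) dz for the counterclockwise parametrization z = exp(it),
   dz = i exp(it) dt. *)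
Definition contour_integral (R : realType) (f : R[i] -> R[i]) : R[i] :=
  complex_integral `[0, 2 * pi] (fun t => f (expi t) * ((0 +i* 1) * expi t)).

(* int_T f(z) dz / (2 pi i z) *)
Definition circle_integral (R : realType) (f : R[i] -> R[i]) : R[i] :=
  contour_integral (fun z => f z / (2 * (@pi R)%:C * (0 +i* 1) * z)).

(* The first entry of the tuple is the variable of the outermost integral. *)
Fixpoint iterated_circle_integral (R : realType) (n : nat) :
    (n.-tuple R[i] -> R[i]) -> R[i] :=
  match n with
  | 0%N => fun F => F [tuple]
  | n'.+1 => fun F =>
      circle_integral (fun z =>
        iterated_circle_integral (fun t : n'.-tuple R[i] => F [tuple of z :: t]))
  end.

Definition fourier_coef (R : realType) (w : R[i] -> R[i]) (k : int) : R[i] :=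
  circle_integral (fun z => z ^ (- k) * w z).

Definition detD (R : realType) (w : R[i] -> R[i]) (n : nat) (r : int) : R[i] :=
  \det (\matrix_(j < n, k < n) fourier_coef w (r + 2 * j%:Z - k%:Z)).

Definition detE (R : realType) (w : R[i] -> R[i]) (n : nat) (s : int) : R[i] :=
  \det (\matrix_(j < n, k < n) fourier_coef w (s + j%:Z - 2 * k%:Z)).

(* Main.v *)
(* Each integrand is a product of two Vandermonde determinants and of one-variable
   weights.  Expanding both determinants over permutations turns the iterated
   integral into a finite combination of products of one-variable integrals,
   which are Fourier coefficients of [w]; only linearity of the circle integral is
   needed, not Fubini's theorem.  Resumming gives n! times the determinant. *)
Require Import Defs.
From HB Require Import structures.
From mathcomp Require Import all_boot all_order all_algebra.
From mathcomp Require Import perm.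
From mathcomp Require Import ring.
From mathcomp Require Import complex.
From mathcomp Require Import all_classical all_reals all_analysis.
From mathcomp Require Import measurable_realfun.

Set Implicit Arguments.
Unset Strict Implicit.
Unset Printing Implicit Defensive.

Import Order.TTheory GRing.Theory Num.Theory.

Local Open Scope ring_scope.
Local Open Scope complex_scope.

(** * The circle integral as a mean over the angle; integrability and linearity *)

Lemma expi_neq0 (R : realType) (t : R) : expi t != 0.
Proof.
apply/eqP => -[c0 s0]; have := cos2Dsin2 t.
by rewrite c0 s0 expr0n addr0 => /esym/eqP; rewrite oner_eq0.
Qed.

Lemma expiV (R : realType) (t : R) : (expi t)^-1 = expi (- t).
Proof.
apply: (mulfI (expi_neq0 t)); rewrite divff ?expi_neq0//.
rewrite /expi cosN sinN; apply/eqP; rewrite eq_complex /=; apply/andP; split.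
  by rewrite mulrN opprK -!expr2 cos2Dsin2.
by rewrite mulrN mulrC addNr.
Qed.

(** The factor $i e^{it}$ of $dz$ cancels against the denominator $2\pi i z$, leaving a real
    constant and no division by the variable. *)
Lemma circle_integralE (R : realType) (f : R[i] -> R[i]) :
  circle_integral f =
  complex_integral `[0, 2 * pi]%classic
    (fun t => ((2 * pi)^-1)%:C * f (expi t)).
Proof.
rewrite /circle_integral /contour_integral; congr complex_integral.
apply/funext => t.
have i_neq0 : (0 +i* 1 : R[i]) != 0.
  by rewrite eq_complex /= oner_eq0 andbF.
have pi_neq0 : (pi%:C : R[i]) != 0 by rewrite fmorph_eq0 gt_eqF ?pi_gt0.
have -> : ((2 * pi)^-1)%:C = (2 * (@pi R)%:C)^-1 :> R[i].
  by rewrite fmorphV rmorphM rmorph_nat.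
(* Generalizing to arbitrary nonzero elements lets [field] treat them as atoms. *)
move: (expi t) (expi_neq0 t) (0 +i* 1) i_neq0 ((@pi R)%:C) pi_neq0 => z z0 j j0 p p0.
by field; rewrite z0 j0 p0.
Qed.

Lemma circle_integrableD (R : realType) (f g : R[i] -> R[i]) :
  circle_integrable f -> circle_integrable g ->
  circle_integrable (fun z => f z + g z).
Proof.
move=> [fr fi] [gr gi]; split.
- apply: eq_integrable (integrableD _ fr gr) => //= t _.
  by case: (f _) (g _) => [a b] [c d].
- apply: eq_integrable (integrableD _ fi gi) => //= t _.
  by case: (f _) (g _) => [a b] [c d].
Qed.

(** Each component of the product is a sum or difference of two terms, each an integrable real
    function times a bounded measurable one. *)
Lemma circle_integrableM (R : realType) (g f : R[i] -> R[i]) :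
  measurable_fun `[0, 2 * (pi : R)]%classic (fun t => complex.Re (g (expi t))) ->
  measurable_fun `[0, 2 * (pi : R)]%classic (fun t => complex.Im (g (expi t))) ->
  [bounded complex.Re (g (expi t)) | t in `[0, 2 * pi]%classic] ->
  [bounded complex.Im (g (expi t)) | t in `[0, 2 * pi]%classic] ->
  circle_integrable f -> circle_integrable (fun z => f z * g z).
Proof.
move=> mr mi br bi [fr fi]; split.
- apply: eq_integrable (integrableB _ (integrableMl _ fr mr br)
    (integrableMl _ fi mi bi)) => //= t _.
  by case: (f _) (g _) => [a b] [c d].
- apply: eq_integrable (integrableD _ (integrableMl _ fr mi bi)
    (integrableMl _ fi mr br)) => //= t _.
  by case: (f _) (g _) => [a b] [c d].
Qed.

Lemma circle_integrableZ (R : realType) (c : R[i]) (f : R[i] -> R[i]) :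
  circle_integrable f -> circle_integrable (fun z => c * f z).
Proof.
move=> f_int; under eq_fun do rewrite mulrC.
by apply: (@circle_integrableM _ (fun=> c)) => //; exact: bounded_cst.
Qed.

Lemma circle_integralD (R : realType) (f g : R[i] -> R[i]) :
  circle_integrable f -> circle_integrable g ->
  circle_integral (fun z => f z + g z) = circle_integral f + circle_integral g.
Proof.
move=> f_int g_int; rewrite !circle_integralE /complex_integral.
pose a := (2 * (pi : R))^-1.
(* The factor $1/(2\pi)$ sits inside the integrand, so additivity is applied to the scaled
   functions. *)
have scaled (h : R[i] -> R[i]) : circle_integrable h ->
    circle_integrable (fun z => a%:C * h z).
  exact: circle_integrableZ.
have [fr fi] := scaled f f_int; have [gr gi] := scaled g g_int.
apply/eqP; rewrite eq_complex /=; apply/andP; split; apply/eqP.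
- rewrite -RintegralD//; apply: eq_Rintegral => t _.
  by rewrite mulrDr raddfD.
- rewrite -RintegralD//; apply: eq_Rintegral => t _.
  by rewrite mulrDr raddfD.
Qed.

Lemma circle_integralZ (R : realType) (c : R[i]) (f : R[i] -> R[i]) :
  circle_integrable f ->
  circle_integral (fun z => c * f z) = c * circle_integral f.
Proof.
move=> f_int; rewrite !circle_integralE.
have [gr gi] := circle_integrableZ ((2 * (pi : R))^-1)%:C f_int.
pose g t := ((2 * (pi : R))^-1)%:C * f (expi t).
have -> : (fun t => ((2 * pi)^-1)%:C * (c * f (expi t))) =
    (fun t => c * g t).
  by apply/funext => t; rewrite mulrCA.
rewrite -/g in gr gi *; case: c => a b.
have scale d (h : R -> R) :
    (@lebesgue_measure R).-integrable `[0, 2 * pi]%classic (EFin \o h) ->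
    (@lebesgue_measure R).-integrable `[0, 2 * pi]%classic
      (EFin \o (fun t => d * h t)).
  exact: integrableZl.
apply/eqP; rewrite eq_complex /=; apply/andP; split; apply/eqP.
- rewrite -!RintegralZl// -RintegralB//; [|exact: scale..].
  by apply: eq_Rintegral => t _; case: (g t).
- rewrite -!RintegralZl// -RintegralD//; [|exact: scale..].
  by apply: eq_Rintegral => t _; case: (g t) => u v /=; rewrite addrC.
Qed.

(** On the circle both $z$ and $z^{-1}$ have components $\cos t$ and $\pm\sin t$, continuous and
    bounded by 1. The boolean [e] treats positive and negative powers together. *)
Lemma circle_integrable_expi (R : realType) (e : bool) (f : R[i] -> R[i]) :
  circle_integrable f ->
  circle_integrable (fun z => f z * (if e then z else z^-1)).
Proof.
move=> f_int.
have bounded1 (h : R -> R) : (forall t, `|h t| <= 1) ->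
    [bounded h t | t in `[0, 2 * pi]%classic].
  move=> h1; exists 1; split => // x x1 t _.
  by apply: le_trans (h1 t) _; exact: ltW.
have mcos : measurable_fun `[0, 2 * pi]%classic (@cos R).
  by apply: measurable_funTS; exact: (continuous_measurable_fun (@continuous_cos R)).
have msin : measurable_fun `[0, 2 * pi]%classic (@sin R).
  by apply: measurable_funTS; exact: (continuous_measurable_fun (@continuous_sin R)).
case: e; first by apply: (@circle_integrableM _ id) => //=; apply: bounded1;
  [exact: cos_max|exact: sin_max].
have ReV (t : R) : complex.Re (expi t)^-1 = cos t by rewrite expiV /= cosN.
have ImV (t : R) : complex.Im (expi t)^-1 = - sin t by rewrite expiV /= sinN.
apply: (@circle_integrableM _ (fun z => z^-1)) f_int.
- by rewrite (funext ReV).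
- by rewrite (funext ImV); exact: measurable_funN.
- by apply: bounded1 => t; rewrite ReV; exact: cos_max.
- by apply: bounded1 => t; rewrite ImV normrN; exact: sin_max.
Qed.

Lemma circle_integrable_exprz (R : realType) (f : R[i] -> R[i]) (k : int) :
  circle_integrable f -> circle_integrable (fun z => f z * z ^ k).
Proof.
(* [g] varies in the induction because each step absorbs one factor $z^{\pm1}$ into it. *)
have int_X e n g : circle_integrable g -> circle_integrable
    (fun z : R[i] => g z * (if e then z else z^-1) ^+ n).
  elim: n g => [|n IHn] g g_int.
    by under eq_fun do rewrite expr0 mulr1.
  under eq_fun do rewrite exprS mulrA.
  exact/IHn/circle_integrable_expi.
move=> f_int; case: k => n; first exact: (int_X true).
under eq_fun do rewrite NegzE -exprz_inv.
exact: (int_X false).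
Qed.

(** * Finite sums and iterated integrals *)

Lemma circle_integral_sum (R : realType) (I : Type) (r : seq I)
    (c : I -> R[i]) (f : I -> R[i] -> R[i]) :
  (forall i, circle_integrable (f i)) ->
  circle_integrable (fun z => \sum_(i <- r) c i * f i z) /\
  circle_integral (fun z => \sum_(i <- r) c i * f i z) =
    \sum_(i <- r) c i * circle_integral (f i).
Proof.
(* Both claims go in one induction: additivity at each step needs integrability of the remaining
   sum. *)
move=> f_int; elim: r => [|i r [IH1 IH2]].
  have zero_int : circle_integrable (fun=> 0 : R[i]) by split; exact: integrable0.
  have zero_fun : (fun z => \sum_(i <- [::]) c i * f i z) = (fun=> 0).
    by apply/funext => z; rewrite big_nil.
  split; first by rewrite zero_fun.
  have := circle_integralZ 0 zero_int.
  by rewrite !mul0r zero_fun big_nil.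
have -> : (fun z => \sum_(j <- i :: r) c j * f j z) =
    (fun z => c i * f i z + \sum_(j <- r) c j * f j z).
  by apply/funext => z; rewrite big_cons.
have ci := circle_integrableZ (c i) (f_int i).
split; first exact: circle_integrableD.
by rewrite circle_integralD// circle_integralZ// IH2 big_cons.
Qed.

(** For a fixed outermost variable its factor is a constant for the inner integrals, so it joins the
    coefficient; induction evaluates these, and linearity of the outer integral finishes. *)
Lemma iterated_circle_integral_sum_prod (R : realType) (I : Type) (r : seq I)
    (n : nat) (c : I -> R[i]) (f : I -> 'I_n -> R[i] -> R[i]) :
  (forall i j, circle_integrable (f i j)) ->
  iterated_circle_integral (fun t : n.-tuple R[i] =>
    \sum_(i <- r) c i * \prod_(j < n) f i j (tnth t j)) =
  \sum_(i <- r) c i * \prod_(j < n) circle_integral (f i j).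
Proof.
elim: n c f => [|n IHn] c f f_int.
  by rewrite /=; apply: eq_bigr => i _; rewrite !big_ord0.
rewrite /=.
under eq_fun => z.
  under eq_fun => t.
    under eq_bigr => i _.
      rewrite big_ord_recl mulrA tnth0.
      under eq_bigr => j _ do rewrite tnthS.
      over.
    over.
  rewrite (IHn (fun i => c i * f i ord0 z) (fun i j => f i (lift ord0 j)));
    last by move=> i j; exact: f_int.
  under eq_bigr => i _ do rewrite mulrAC.
  over.
rewrite (circle_integral_sum _ _ (fun i => f_int i ord0)).2.
by apply: eq_bigr => i _; rewrite big_ord_recl mulrA mulrAC.
Qed.

(* Andreief's identity: in the double permutation expansion of the integrand,
   the terms with a fixed permutation [q] of the [phi j] integrate to the
   expansion of the determinant with rows permuted by [q]. *)
Lemma Andreief (R : realType) (n : nat) (w : R[i] -> R[i])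
    (phi psi : 'I_n -> R[i] -> R[i]) :
  (forall j k, circle_integrable (fun z => w z * (phi j z * psi k z))) ->
  iterated_circle_integral (fun t : n.-tuple R[i] =>
    (\prod_(i < n) w (tnth t i)) *
    (\det (\matrix_(i, j) phi j (tnth t i)) *
     \det (\matrix_(i, k) psi k (tnth t i)))) =
  n`!%:R *
  \det (\matrix_(j, k) circle_integral (fun z => w z * (phi j z * psi k z))).
Proof.
move=> int_w.
(* Factors are grouped by variable: the [i]-th one carries [phi (q i)] and [psi (s i)]. *)
pose f (qs : 'S_n * 'S_n) i z := w z * (phi (qs.1 i) z * psi (qs.2 i) z).
pose c (qs : 'S_n * 'S_n) : R[i] := (-1) ^+ qs.1 * (-1) ^+ qs.2.
under eq_fun => t.
  rewrite (_ : _ * _ = \sum_qs c qs * \prod_(i < n) f qs i (tnth t i)).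
    over.
  rewrite /determinant big_distrlr /= mulr_sumr.
  under [LHS]eq_bigr => q _ do rewrite mulr_sumr.
  rewrite pair_bigA /=; apply: eq_bigr => -[q s] _; rewrite /c /f /=.
  rewrite [X in _ * X]mulrACA [LHS]mulrCA; congr (_ * _).
  by rewrite !big_split /=; congr (_ * (_ * _)); apply: eq_bigr => i _;
    rewrite mxE.
rewrite iterated_circle_integral_sum_prod; last by move=> qs i; exact: int_w.
set M := (X in \det X).
rewrite -(pair_bigA _ (fun q s => c (q, s) *
  \prod_(i < n) circle_integral (f (q, s) i))) /=.
under eq_bigr => q _.
  rewrite (_ : \sum_s _ = \det M).
    over.
  transitivity ((-1) ^+ q * \det (row_perm q M)).
    rewrite [\det (row_perm _ _)]/determinant mulr_sumr.
    apply: eq_bigr => s _; rewrite /c /= -mulrA; congr (_ * (_ * _)).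
    by apply: eq_bigr => i _; rewrite !mxE.
  (* The sign of [q] from the first expansion cancels that of the row permutation, so all $n!$
     permutations contribute equally. *)
  rewrite row_permE det_mulmx det_perm mulrA -expr2 sqrr_sign.
  by rewrite mul1r.
by rewrite sumr_const card_Sn mulr_natl.
Qed.

(** * Vandermonde products and the determinants $D_n$, $E_n$ *)

Lemma det_tuple_powers (R : comNzRingType) (n : nat) (t : 'I_n -> R) :
  \det (\matrix_(i < n, k < n) t i ^+ k) =
  \prod_(i < n) \prod_(j < n | (i < j)%N) (t j - t i).
Proof.
(* [Vandermonde] places its points along the columns. *)
rewrite -det_tr.
have -> : (\matrix_(i < n, k < n) t i ^+ k)^T = Vandermonde n (\row_i t i).
  by apply/matrixP => i j; rewrite !mxE.
rewrite det_Vandermonde; apply: eq_bigr => i _; apply: eq_bigr => j _.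
by rewrite !mxE.
Qed.

(** Exponent laws for integer powers need a nonzero base, so integrands that may differ at 0 are
    compared on the circle only. *)
Lemma circle_integral_eq (R : realType) (f g : R[i] -> R[i]) :
  (forall t, f (expi t) = g (expi t)) -> circle_integral f = circle_integral g.
Proof.
move=> fg; rewrite !circle_integralE; congr complex_integral.
by apply/funext => t; rewrite fg.
Qed.

(* [a = -2, b = 1] gives the D-determinants and [a = -1, b = 2] the
   E-determinants. *)
Lemma Toeplitz_minor_integral (R : realType) (w : R[i] -> R[i]) (n : nat)
    (r a b : int) :
  circle_integrable w ->
  \det (\matrix_(j < n, k < n)
    fourier_coef w (r - a * j%:Z - b * k%:Z)) =
  (n`!%:R)^-1 * iterated_circle_integral (fun zeta : n.-tuple R[i] =>
    (\prod_(j < n) (w (tnth zeta j) * tnth zeta j ^ (- r))) *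
    \prod_(j < n) \prod_(k < n | (j < k)%N)
      ((tnth zeta k ^ b - tnth zeta j ^ b) *
       (tnth zeta k ^ a - tnth zeta j ^ a))).
Proof.
move=> w_int.
have expi_pow t (j k : nat) : (expi t ^ a) ^+ j * (expi t ^ b) ^+ k =
    expi t ^ (a * j%:Z + b * k%:Z) :> R[i].
  by rewrite !exprnP !exprz_exp expfzDr ?expi_neq0.
have eq_expi (j k : nat) t : w (expi t) * expi t ^ (- r) *
    ((expi t ^ a) ^+ j * (expi t ^ b) ^+ k) =
    w (expi t) * expi t ^ (- (r - a * j%:Z - b * k%:Z)).
  rewrite expi_pow -mulrA -expfzDr ?expi_neq0//.
  by congr (_ * _ ^ _); ring.
under [X in iterated_circle_integral X]eq_fun => zeta.
  rewrite (_ : \prod_(j < n) \prod_(k < n | _) _ =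
    \det (\matrix_(i < n, j < n) (tnth zeta i ^ a) ^+ j) *
    \det (\matrix_(i < n, k < n) (tnth zeta i ^ b) ^+ k)).
    over.
  (* Rows carry the powers of $\zeta^a$ and columns those of $\zeta^b$, while the integrand lists
     the [b] differences first. *)
  rewrite [RHS]mulrC (det_tuple_powers (fun i => tnth zeta i ^ a)).
  rewrite (det_tuple_powers (fun i => tnth zeta i ^ b)) -big_split.
  by apply: eq_bigr => j _; rewrite big_split.
rewrite (@Andreief _ _ (fun z => w z * z ^ (- r)) (fun j z => (z ^ a) ^+ j)
  (fun k z => (z ^ b) ^+ k)); last first.
  move=> j k.
  have [intRe intIm] := circle_integrable_exprz
    (- (r - a * j%:Z - b * k%:Z)) w_int.
  by split; [move: intRe|move: intIm]; apply: eq_integrable => // t _;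
    rewrite /= eq_expi.
rewrite mulKf; last by rewrite pnatr_eq0 -lt0n fact_gt0.
congr (\det _); apply/matrixP => j k; rewrite !mxE.
by apply: circle_integral_eq => t; rewrite eq_expi mulrC.
Qed.

Theorem theorem5p1 (R : realType) (w : R[i] -> R[i])
    (w_int : circle_integrable w) (n : nat) (n_ge1 : (1 <= n)%N) (r s : int) :
  detD w n r =
    (n`!%:R)^-1 * iterated_circle_integral (fun zeta : n.-tuple R[i] =>
      (\prod_(j < n) (w (tnth zeta j) * tnth zeta j ^ (- r))) *
      \prod_(j < n) \prod_(k < n | (j < k)%N)
        ((tnth zeta k - tnth zeta j) *
         (tnth zeta k ^ (- 2%:Z) - tnth zeta j ^ (- 2%:Z))))
  /\
  detE w n s =
    (n`!%:R)^-1 * iterated_circle_integral (fun zeta : n.-tuple R[i] =>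
      (\prod_(j < n) (w (tnth zeta j) * tnth zeta j ^ (- s))) *
      \prod_(j < n) \prod_(k < n | (j < k)%N)
        ((tnth zeta k ^+ 2 - tnth zeta j ^+ 2) *
         ((tnth zeta k)^-1 - (tnth zeta j)^-1))).
Proof.
split.
- rewrite /detD -[X in X = _](_ : \det (\matrix_(j < n, k < n)
    fourier_coef w (r - (- 2) * j%:Z - 1 * k%:Z)) = _); last first.
    by congr (\det _); apply/matrixP => j k; rewrite !mxE mul1r mulNr opprK.
  (* The exponent 1 disappears by computation, as do the exponents $-1$ and 2 in the case of
     [detE]. *)
  by rewrite Toeplitz_minor_integral.
- rewrite /detE -[X in X = _](_ : \det (\matrix_(j < n, k < n)
    fourier_coef w (s - (- 1) * j%:Z - 2 * k%:Z)) = _); last first.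
    by congr (\det _); apply/matrixP => j k; rewrite !mxE mulN1r opprK.
  by rewrite Toeplitz_minor_integral.
Qed.
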